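(* Let $\mathcal X=\mathbb{R}^n$ or $\mathcal X=\mathbb{R}^n_+$, let $\gamma>0$, and let $\Phi:\mathbb{R}^n\to\mathbb{R}$ be smooth. Let $$F_u(x)=\gamma\frac{\|x\|_1}{\|x\|_2}+\Phi(x).$$ Then for every $x_0\in\mathcal X$ with $x_0\neq 0$, the function $F_u+\iota_{\mathcal X}$ is partly smooth at $x_0$ relative to $$\mathcal M_{x_0}=\{x\in\mathbb{R}^n\mid \mathrm{supp}(x)=\mathrm{supp}(x_0)\}.$$
   Context: Convention: $\|0\|_1/\|0\|_2:=1$. $\iota_{\mathcal X}$ is the indicator function of $\mathcal X$ ($0$ on $\mathcal X$, $+\infty$ off $\mathcal X$). $\mathrm{supp}(x)=\{i: x_i\ne0\}$. Smooth means $C^1$; the paper's convention is that a $C^1$ function is a differentiable function with Lipschitz continuous gradient. A set $\mathcal M$ is a manifold around $x$ if $x\in\mathcal M$ and there is an open set $V\ni x$ such that $\mathcal M\cap V=\{z\in V\mid \Psi(z)=0\}$, where $\Psi$ is a smooth map whose derivative is surjective throughout $V$. $N_{\mathcal M}(x)$ is the normal space to $\mathcal M$ at $x$; in particular $N_{\mathcal M_{x_0}}(x)=\{w\in\mathbb{R}^n\mid w_j=0\ \ \forall j\in\mathrm{supp}(x_0)\}$. For $h:\mathbb{R}^n\to[-\infty,+\infty]$ finite at $x$: - subderivative: $dh(x)(\bar w)=\liminf_{\tau\downarrow0,\ w\to\bar w}\frac{h(x+\tau w)-h(x)}{\tau}$; - regular subdifferential: $\hat\partial h(x)=\{v\mid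 \liminf_{z\to x,\,z\neq x}\frac{h(z)-h(x)-\langle v,z-x\rangle}{\|z-x\|_2}\ge0\}$; - limiting subdifferential: $\partial h(x)=\{v\mid\exists\,x^r\to x,\ h(x^r)\to h(x),\ v^r\in\hat\partial h(x^r),\ v^r\to v\}$; - horizon subdifferential: $\partial^\infty h(x)=\{\lim_r\lambda_rv^r\mid v^r\in\partial h(x^r),\ x^r\to x,\ h(x^r)\to h(x),\ \lambda_r\downarrow0\}$; - when $\partial h(x)\ne\emptyset$, $h$ is regular at $x$ iff $h$ is locally lower semicontinuous at $x$, $\partial h(x)=\hat\partial h(x)$, and $\partial^\infty h(x)=\hat\partial h(x)^\infty$ (the recession cone of $\hat\partial h(x)$). Partly smooth: let $\mathcal M\subset\mathbb{R}^n$ contain $x$. A function $f:\mathbb{R}^n\to[-\infty,+\infty]$ is partly smooth at $x$ relative to $\mathcal M$ if $\mathcal M$ is a manifold around $x$ and (i) (restricted smoothness) the restriction $f|_{\mathcal M}$ is smooth around $x$ (i.e. agrees on $\mathcal M$ near $x$ with a smooth function defined near $x$); (ii) (regularity) at every point of $\mathcal M$ close to $x$, $f$ is regular and has a subgradient; (iii) (normal sharpness) $df(x)(-w)>-df(x)(w)$ for all nonzero $w\in N_{\mathcal M}(x)$; (iv) (subgradient continuity) the subdifferential map $\partial f$ is continuous at $x$ relative to $\mathcal M$. Given (i), this is equivalent to inner semicontinuity: for any sequence $x^r\in\mathcal M$ with $x^r\to x$ and any $y\in\partial f(x)$ there exist $y^r\in\partial f(x^r)$ with $y^r\to y$. *)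

(* Defs.v *)
From mathcomp Require Import all_boot all_order all_algebra.
From mathcomp Require Import all_classical all_reals all_analysis.
Set Implicit Arguments.
Unset Strict Implicit.
Unset Printing Implicit Defensive.
Import Order.TTheory GRing.Theory Num.Theory.
Import numFieldNormedType.Exports.
Local Open Scope classical_set_scope.
Local Open Scope ring_scope.

(* R^n is 'rV[R]_n; its topology, and the norm used by [lipschitz _ | _ in _],
   are those of the library's sup norm.  As n is fixed, having a Lipschitz
   gradient or Jacobian does not depend on the choice of norms. *)

Section euclidean.
Context {R : realType} {n : nat}.
Implicit Types x y : 'rV[R]_n.

Definition dotp x y : R := \sum_(i < n) x 0 i * y 0 i.
Definition norm1 x : R := \sum_(i < n) `|x 0 i|.
Definition norm2 x : R := Num.sqrt (\sum_(i < n) x 0 i ^+ 2).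

Definition ratio12 x : R := if x == 0 then 1 else norm1 x / norm2 x.

Definition supp x : {set 'I_n} := [set i | x 0 i != 0]%SET.

Definition orthant : set 'rV[R]_n := [set x | forall i, 0 <= x 0 i].

Definition ind_fun (X : set 'rV[R]_n) x : \bar R :=
  if x \in X then 0%E else +oo%E.

End euclidean.

Section smooth.
Context {R : realType} {n : nat}.

Definition gradient (f : 'rV[R]_n -> R) (x : 'rV[R]_n) : 'rV[R]_n :=
  \row_(i < n) 'd f x (delta_mx 0 i).

(* "C^1" is taken in the sense: differentiable with Lipschitz derivative. *)
Definition smooth_fun (A : set 'rV[R]_n) (f : 'rV[R]_n -> R) : Prop :=
  (forall x, A x -> differentiable f x) /\ [lipschitz gradient f x | x in A].

Definition smooth_map m (A : set 'rV[R]_n) (f : 'rV[R]_n -> 'rV[R]_m) : Prop :=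
  (forall x, A x -> differentiable f x) /\ [lipschitz 'J f x | x in A].

Definition local_equation (M : set 'rV[R]_n) (x : 'rV[R]_n) m
    (V : set 'rV[R]_n) (Psi : 'rV[R]_n -> 'rV[R]_m) : Prop :=
  [/\ open V, V x, smooth_map V Psi,
      forall z, V z -> set_surj setT setT ('d Psi z)
    & M `&` V = [set z | V z /\ Psi z = 0]].

Definition manifold_around (M : set 'rV[R]_n) (x : 'rV[R]_n) : Prop :=
  M x /\ exists m V (Psi : 'rV[R]_n -> 'rV[R]_m), local_equation M x V Psi.

(* The kernel of the derivative at x is the same for all local equations of a
   manifold around x. *)
Definition tangent_subspace (M : set 'rV[R]_n) (x : 'rV[R]_n) : set 'rV[R]_n :=
  [set w | exists m V (Psi : 'rV[R]_n -> 'rV[R]_m),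
    local_equation M x V Psi /\ 'd Psi x w = 0].

Definition normal_subspace (M : set 'rV[R]_n) (x : 'rV[R]_n) : set 'rV[R]_n :=
  [set w | forall t, tangent_subspace M x t -> dotp w t = 0].

End smooth.

Section subdifferentials.
Context {R : realType} {n : nat}.
Implicit Types (h : 'rV[R]_n -> \bar R) (x v w : 'rV[R]_n).

(* Meaningful only when h x is finite. *)
Definition subderivative h x w : \bar R :=
  limf_einf (fun p : R * 'rV[R]_n =>
      ((h (x + p.1 *: p.2)%R - h x) * (p.1^-1)%:E)%E)
    (filter_prod 0^'+ (nbhs w)).

(* As usual, the subdifferentials are empty where h is not finite. *)
Definition regular_subdiff h x : set 'rV[R]_n :=
  [set v | h x \is a fin_num /\
    (0 <= limf_einf (fun z : 'rV[R]_n =>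
            (h z - h x - (dotp v (z - x)%R)%:E) * ((norm2 (z - x)%R)^-1)%:E)
          x^')%E].

Definition limiting_subdiff h x : set 'rV[R]_n :=
  [set v | h x \is a fin_num /\
    exists xr vr : nat -> 'rV[R]_n,
      [/\ xr r @[r --> \oo] --> x, h (xr r) @[r --> \oo] --> h x,
          forall r, regular_subdiff h (xr r) (vr r)
        & vr r @[r --> \oo] --> v]].

Definition horizon_subdiff h x : set 'rV[R]_n :=
  [set w | h x \is a fin_num /\
    exists (xr vr : nat -> 'rV[R]_n) (lam : nat -> R),
      [/\ xr r @[r --> \oo] --> x /\ h (xr r) @[r --> \oo] --> h x,
          forall r, limiting_subdiff h (xr r) (vr r),
          (forall r, 0 < lam r) /\ lam r @[r --> \oo] --> 0
        & lam r *: vr r @[r --> \oo] --> w]].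

Definition recession_cone (C : set 'rV[R]_n) : set 'rV[R]_n :=
  [set w | forall v t, C v -> 0 <= t -> C (v + t *: w)].

(* Rockafellar-Wets, Variational Analysis, Definition 1.33. *)
Definition locally_lsc h x : Prop :=
  h x \is a fin_num /\
  exists2 e : R, 0 < e & forall a : R, (a%:E <= h x + e%:E)%E ->
    closed [set z | norm2 (z - x) <= e /\ (h z <= a%:E)%E].

(* Only used where limiting_subdiff h x is nonempty. *)
Definition regular_at h x : Prop :=
  [/\ locally_lsc h x,
      limiting_subdiff h x = regular_subdiff h x
    & horizon_subdiff h x = recession_cone (regular_subdiff h x)].

End subdifferentials.

Section set_valued_continuity.
Context {R : realType} {n : nat}.
Implicit Types (S : 'rV[R]_n -> set 'rV[R]_n) (M : set 'rV[R]_n).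

Definition outer_semicontinuous S M (x : 'rV[R]_n) : Prop :=
  forall (xr yr : nat -> 'rV[R]_n) (y : 'rV[R]_n),
    (forall r, M (xr r)) -> xr r @[r --> \oo] --> x ->
    (forall r, S (xr r) (yr r)) -> yr r @[r --> \oo] --> y -> S x y.

(* Membership is only asked for all large r: S may be empty at points of M far
   from x. *)
Definition inner_semicontinuous S M (x : 'rV[R]_n) : Prop :=
  forall (xr : nat -> 'rV[R]_n) (y : 'rV[R]_n),
    (forall r, M (xr r)) -> xr r @[r --> \oo] --> x -> S x y ->
    exists yr : nat -> 'rV[R]_n,
      (\forall r \near \oo, S (xr r) (yr r)) /\ yr r @[r --> \oo] --> y.

Definition continuous_relative S M (x : 'rV[R]_n) : Prop :=
  outer_semicontinuous S M x /\ inner_semicontinuous S M x.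

End set_valued_continuity.

Record partly_smooth {R : realType} {n : nat} (f : 'rV[R]_n -> \bar R)
    (x : 'rV[R]_n) (M : set 'rV[R]_n) : Prop := PartlySmooth {
  ps_manifold : manifold_around M x;
  ps_restricted_smoothness :
    exists (U : set 'rV[R]_n) (g : 'rV[R]_n -> R),
      [/\ open U, U x, smooth_fun U g
        & forall z, M z -> U z -> f z = (g z)%:E];
  ps_regularity :
    \forall z \near x, M z ->
      regular_at f z /\ limiting_subdiff f z !=set0;
  ps_normal_sharpness :
    forall w, normal_subspace M x w -> w != 0 ->
      (- subderivative f x w < subderivative f x (- w)%R)%E;
  ps_subgradient_continuity :
    continuous_relative (limiting_subdiff f) M x }.

Definition same_supp {R : realType} {n : nat} (x0 : 'rV[R]_n) : set 'rV[R]_n :=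
  [set x | supp x = supp x0].

Definition Fu {R : realType} {n : nat} (gamma : R) (Phi : 'rV[R]_n -> R)
    (x : 'rV[R]_n) : R := gamma * ratio12 x + Phi x.

(* Main.v *)
From HB Require Import structures.
Require Import Defs.
From mathcomp Require Import all_boot all_order all_algebra.
From mathcomp Require Import all_classical all_reals all_analysis.
From mathcomp Require Import ring lra.
Import Order.TTheory GRing.Theory Num.Theory.
Import numFieldNormedType.Exports.
Local Open Scope classical_set_scope.
Local Open Scope ring_scope.
Set Implicit Arguments.
Unset Strict Implicit.
Unset Printing Implicit Defensive.

(** Away from the origin the objective is a product plus a smooth term,
      F y = c y * norm1 y + Phi y   with   c y = gamma / norm2 y,
    where c is positive and differentiable and norm1 is convex; X is closed and
    convex.  Put b x = gradient Phi x + norm1 x *: gradient c x, the part of the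
    product rule that differentiates Phi and c.  The whole proof rests on one
    description of the subgradients at a point x of X other than 0
    ([regular_subdiff_product], [regular_subdiff_Fu]): v is a regular
    subgradient of F + indicator of X iff
      dotp (v - b x) (y - x) <= c x * (norm1 y - norm1 x)   for all y in X,
    that is, iff v = b x + c x *: s with s a convex subgradient of norm1 +
    indicator of X.  Local first-order information thus becomes a family of
    global inequalities whose ingredients are continuous in x.

    Regularity.  These inequalities survive passage to the limit, X being
    closed, so limiting and regular subgradients coincide.  For the horizon
    subdifferential, multiply the inequality at x^r by lam_r: in the limit it
    says that dotp w (y - x) <= 0 on X, which makes w a recession direction; the
    converse inclusion holds for every function with a regular subgradient.

    Continuity of the subdifferential.  Let z have the support of x and be
    close to x.  Then x - z / 2 still lies in X and norm1 x - norm1 z / 2 is its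
    1-norm, so the inequality at x tested at x + (y - z) / 2 implies the
    inequality at z tested at y ([subgradient_sign_close]).  Hence
    norm1 + indicator of X has at z every subgradient it has at x, and only b
    and c vary.

    Normal sharpness.  A normal vector w vanishes on the support of x.  The sign
    vector of x plus or minus that of w are both subgradients of norm1, and
    regular subgradients minorize the subderivative; their difference paired
    with w is 2 * norm1 w > 0.

    Restricted smoothness.  On vectors with the support of x0 and close to x0,
    norm1 is the linear form with coefficients the signs of x0.  Divided by
    norm2 it has a Lipschitz gradient near x0, because bounded Lipschitz
    functions are closed under sums, products, and inverses and square roots of
    functions bounded below by a positive constant. *)

(** * The norms and the inner product *)
Section euclidean_facts.
Context {R : realType} {n : nat}.
Implicit Types (x y v w : 'rV[R]_n) (t : R).

Lemma dotpC x y : dotp x y = dotp y x.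
Proof. by apply: eq_bigr => i _; rewrite mulrC. Qed.

Lemma dotpDr v x y : dotp v (x + y) = dotp v x + dotp v y.
Proof. by rewrite -big_split; apply: eq_bigr => i _; rewrite mxE mulrDr. Qed.

Lemma dotpZr v t x : dotp v (t *: x) = t * dotp v x.
Proof. by rewrite mulr_sumr; apply: eq_bigr => i _; rewrite mxE mulrCA. Qed.

Lemma dotpNr v x : dotp v (- x) = - dotp v x.
Proof. by rewrite -scaleN1r dotpZr mulN1r. Qed.

Lemma dotpBr v x y : dotp v (x - y) = dotp v x - dotp v y.
Proof. by rewrite dotpDr dotpNr. Qed.

Lemma dotp0r v : dotp v 0 = 0.
Proof. by rewrite -(scale0r 0) dotpZr mul0r. Qed.

Lemma dotpDl x y v : dotp (x + y) v = dotp x v + dotp y v.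
Proof. by rewrite dotpC dotpDr !(dotpC v). Qed.

Lemma dotpZl t x v : dotp (t *: x) v = t * dotp x v.
Proof. by rewrite dotpC dotpZr dotpC. Qed.

Lemma dotpNl x v : dotp (- x) v = - dotp x v.
Proof. by rewrite dotpC dotpNr dotpC. Qed.

Lemma dotpBl x y v : dotp (x - y) v = dotp x v - dotp y v.
Proof. by rewrite dotpDl dotpNl. Qed.

Lemma dotp_delta w j : dotp w (delta_mx 0 j) = w 0 j.
Proof.
rewrite /dotp (bigD1 j)//= big1 ?addr0 => [|i /negPf ij].
  by rewrite mxE !eqxx mulr1.
by rewrite mxE ij andbF mulr0.
Qed.

Lemma coord_le_norm x i : `|x 0 i| <= `|x|.
Proof.
rewrite [leRHS]/Num.Def.normr/= mx_normrE.
exact: (le_bigmax _ (fun ij : 'I_1 * 'I_n => `|x ij.1 ij.2|) (0, i)).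
Qed.

Lemma norm_le_coords x t : 0 <= t -> (forall i, `|x 0 i| <= t) -> `|x| <= t.
Proof.
move=> t0 xt; rewrite [leLHS]/Num.Def.normr/= mx_normrE.
by apply: bigmax_le => // -[i j] _; rewrite (ord1 i).
Qed.

Lemma norm1Z t x : norm1 (t *: x) = `|t| * norm1 x.
Proof. by rewrite mulr_sumr; apply: eq_bigr => i _; rewrite mxE normrM. Qed.

Lemma norm1D x y : norm1 (x + y) <= norm1 x + norm1 y.
Proof. by rewrite -big_split; apply: ler_sum => i _; rewrite mxE ler_normD. Qed.

Lemma norm1_ge0 x : 0 <= norm1 x.
Proof. by apply: sumr_ge0 => i _. Qed.

Lemma sumsq_ge0 x : 0 <= \sum_(i < n) x 0 i ^+ 2.
Proof. by apply: sumr_ge0 => i _; exact: sqr_ge0. Qed.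

Lemma sqr_norm2 x : norm2 x ^+ 2 = \sum_(i < n) x 0 i ^+ 2.
Proof. by rewrite sqr_sqrtr// sumsq_ge0. Qed.

Lemma norm2_ge0 x : 0 <= norm2 x.
Proof. exact: sqrtr_ge0. Qed.

Lemma norm2Z t x : norm2 (t *: x) = `|t| * norm2 x.
Proof.
rewrite /norm2 (eq_bigr (fun i => t ^+ 2 * x 0 i ^+ 2)) => [|i _].
  by rewrite -mulr_sumr sqrtrM ?sqr_ge0// sqrtr_sqr.
by rewrite mxE exprMn.
Qed.

Lemma norm_le_norm2 x : `|x| <= norm2 x.
Proof.
apply: norm_le_coords => [|i]; first exact: norm2_ge0.
rewrite -sqrtr_sqr ler_wsqrtr// (bigD1 i)//= lerDl.
by apply: sumr_ge0 => j _; exact: sqr_ge0.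
Qed.

Lemma norm2_gt0 x : x != 0 -> 0 < norm2 x.
Proof. by move=> x0; rewrite (lt_le_trans _ (norm_le_norm2 x))// normr_gt0. Qed.

Lemma norm2_0 : norm2 (0 : 'rV[R]_n) = 0.
Proof. by rewrite -(scale0r 0) norm2Z normr0 mul0r. Qed.

Lemma dotp_le v x : `|dotp v x| <= norm1 v * `|x|.
Proof.
apply: le_trans (ler_norm_sum _ _ _) _; rewrite mulr_suml.
by apply: ler_sum => i _; rewrite normrM ler_wpM2l// coord_le_norm.
Qed.

Lemma cvg_sum_coord (T : Type) (F : set_system T) {FF : Filter F}
    (g : 'I_n -> T -> R) (l : 'I_n -> R) :
  (forall i, g i @ F --> l i) ->
  (fun u => \sum_(i < n) g i u) @ F --> \sum_(i < n) l i.
Proof.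
by move=> gl; apply: cvg_big => // -[a b]; exact: add_continuous.
Qed.

Lemma cvg_coord (T : Type) (F : set_system T) {FF : Filter F}
    (f : T -> 'rV[R]_n) x i :
  f @ F --> x -> (fun u => f u 0 i) @ F --> x 0 i.
Proof.
by move=> fx; exact: (cvg_comp _ _ fx (@coord_continuous _ _ _ 0 i x)).
Qed.

Lemma cvg_dotp (T : Type) (F : set_system T) {FF : Filter F}
    (f g : T -> 'rV[R]_n) x y :
  f @ F --> x -> g @ F --> y -> (fun u => dotp (f u) (g u)) @ F --> dotp x y.
Proof.
by move=> fx gy; apply: cvg_sum_coord => i; apply: cvgM; exact: cvg_coord.
Qed.

Lemma continuous_norm1 : continuous (@norm1 R n).
Proof.
move=> x; apply: (cvg_sum_coord (F := nbhs x)) => i.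
by apply: cvg_norm; exact: coord_continuous.
Qed.

Lemma continuous_norm2 : continuous (@norm2 R n).
Proof.
move=> x.
apply: (@continuous_comp _ _ _ (fun y : 'rV[R]_n => \sum_i y 0 i ^+ 2));
  last exact: sqrt_continuous.
apply: (cvg_sum_coord (F := nbhs x)) => i; under eq_fun do rewrite expr2.
by apply: cvgM; exact: coord_continuous.
Qed.

End euclidean_facts.

(** * Lower limits as eventual inequalities *)
Section liminf.
Context {R : realType} {T : choiceType} {X : filteredType T}.
Variables (f : X -> \bar R) (F : set_system X).
Hypothesis FF : Filter F.
Implicit Types a e : R.

Lemma limf_einf_ge a :
  (forall e, 0 < e -> \forall p \near F, ((a - e)%:E <= f p)%E) ->
  (a%:E <= limf_einf f F)%E.
Proof.
move=> H; apply/lee_addgt0Pr => e e0; rewrite -leeBlDr// -EFinB limf_einfE.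
have Fe := H _ e0; apply: le_trans (ereal_sup_ubound _); last first.
  by exists [set p | ((a - e)%:E <= f p)%E].
by apply: le_ereal_inf_tmp => _ [p + <-].
Qed.

Lemma limf_einf_near a : (a%:E <= limf_einf f F)%E ->
  forall e, 0 < e -> \forall p \near F, ((a - e)%:E <= f p)%E.
Proof.
move=> H e e0; have : ((a - e)%:E < limf_einf f F)%E.
  by apply: lt_le_trans H; rewrite lte_fin; lra.
rewrite limf_einfE => /ereal_sup_gt[_ [V FV <-]] /ltW aV.
apply: filterS FV => p Vp; apply: le_trans aV _.
by apply: ereal_inf_lbound; exists p.
Qed.

End liminf.

(** * Regular subgradients of a function restricted to a set *)
Section restriction.
Context {R : realType} {n : nat}.
Implicit Types (F : 'rV[R]_n -> R) (X : set 'rV[R]_n) (x v w : 'rV[R]_n).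

Definition restr F X x : \bar R := ((F x)%:E + ind_fun X x)%E.

Lemma restr_in F X x : X x -> restr F X x = (F x)%:E.
Proof. by move=> Xx; rewrite /restr /ind_fun mem_set// adde0. Qed.

Lemma restr_out F X x : ~ X x -> restr F X x = +oo%E.
Proof. by move=> Xx; rewrite /restr /ind_fun memNset. Qed.

Lemma restr_fin_num F X x : restr F X x \is a fin_num -> X x.
Proof. by apply: contraPP => Xx; rewrite restr_out. Qed.

Lemma regular_subdiffP F X x v :
  regular_subdiff (restr F X) x v <-> X x /\
    forall e, 0 < e -> \forall y \near x, X y ->
      F x + dotp v (y - x) - e * norm2 (y - x) <= F y.
Proof.
split=> [[/restr_fin_num Xx]|[Xx H]].
  rewrite restr_in// => /limf_einf_near H; split=> // e e0.
  have := H _ e0; rewrite near_withinE; apply: filterS => y Hy Xy.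
  have [->|yx] := eqVneq y x; first by rewrite subrr dotp0r norm2_0; lra.
  move: (Hy yx); rewrite restr_in// sub0r -!EFinB -EFinM lee_fin.
  by rewrite ler_pdivlMr ?norm2_gt0 ?subr_eq0//; lra.
split; first by rewrite restr_in.
rewrite restr_in//; apply: limf_einf_ge => e e0; rewrite near_withinE.
apply: filterS (H _ e0) => y Hy yx.
have n0 : 0 < (norm2 (y - x))^-1 by rewrite invr_gt0 norm2_gt0 ?subr_eq0.
have [Xy|Xy] := pselect (X y); last first.
  by rewrite restr_out// gt0_mulye ?lte_fin// leey.
rewrite restr_in// sub0r -!EFinB -EFinM lee_fin -invr_gt0 in n0 *.
rewrite invrK in n0; rewrite ler_pdivlMr//; have := Hy Xy; lra.
Qed.

(** The regular subgradient inequality, divided by tau along x + tau w'; the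
    error e * norm2 w' stays small because norm2 w' is bounded for w' near w. *)
Lemma dotp_le_subderivative F X x v w : regular_subdiff (restr F X) x v ->
  ((dotp v w)%:E <= subderivative (restr F X) x w)%E.
Proof.
move=> /regular_subdiffP[Xx H]; apply: limf_einf_ge => e e0.
have d0 : 0 < e / 2 / (norm2 w + 1).
  by rewrite !divr_gt0// ltr_wpDl// norm2_ge0.
have t0 : (fun p : R * 'rV[R]_n => p.1) @ filter_prod 0^'+ (nbhs w) --> (0 : R).
  by apply: cvg_trans cvg_fst _; exact: cvg_at_right_filter.
have yx : (fun p : R * 'rV[R]_n => x + p.1 *: p.2) @
    filter_prod 0^'+ (nbhs w) --> x.
  rewrite -[X in _ --> X]addr0 -[in X in _ --> X](scale0r w).
  by apply: cvgD; [exact: cvg_cst|apply: cvgZ => //; exact: cvg_snd].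
have vw : (fun p : R * 'rV[R]_n => dotp v p.2) @
    filter_prod 0^'+ (nbhs w) --> dotp v w.
  by apply: cvg_dotp; [exact: cvg_cst|exact: cvg_snd].
have nw : (fun p : R * 'rV[R]_n => norm2 p.2) @
    filter_prod 0^'+ (nbhs w) --> norm2 w.
  by apply: continuous_cvg; [exact: continuous_norm2|exact: cvg_snd].
near=> p.
have p0 : 0 < p.1.
  by near: p; exact: (cvg_fst (nbhs_right_gt _)).
have n1 : norm2 p.2 <= norm2 w + 1.
  near: p; by apply: (cvgr_le _ nw); lra.
have v1 : dotp v w - e / 2 <= dotp v p.2.
  near: p; by apply: (cvgr_ge _ vw); lra.
have Hp : X (x + p.1 *: p.2) ->
    F x + dotp v (x + p.1 *: p.2 - x) -
      e / 2 / (norm2 w + 1) * norm2 (x + p.1 *: p.2 - x) <= F (x + p.1 *: p.2).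
  by near: p; exact: yx (H _ d0).
have [Xy|Xy] := pselect (X (x + p.1 *: p.2)); last first.
  by rewrite restr_out// restr_in// gt0_mulye ?lte_fin ?invr_gt0// leey.
rewrite !restr_in// -EFinB -EFinM lee_fin ler_pdivlMr//.
move: (Hp Xy); rewrite [x + _ - x]addrC addKr dotpZr norm2Z gtr0_norm//.
have : e / 2 / (norm2 w + 1) * (p.1 * norm2 p.2) <= p.1 * (e / 2).
  rewrite mulrCA ler_pM2l// mulrAC ler_pdivrMr ?ltr_wpDl ?norm2_ge0//.
  by rewrite ler_pM2l// divr_gt0.
have : p.1 * (dotp v w - e / 2) <= p.1 * dotp v p.2 by rewrite ler_pM2l.
lra.
Unshelve. all: by end_near. Qed.

End restriction.

(** * The product rule for regular subgradients *)

(** The two estimates below are the arithmetic of the product rule, with the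
    values of the functions at the two points and the linear terms as
    unknowns. *)
Section first_order_estimates.
Context {R : realFieldType}.

(** Here z = x + t d and cz, gz, Pz are values at z.  Splitting
    cz * gz - cx * gx into cz * (gz - gx) + gx * (cz - cx) leaves only the
    convexity bound gz <= gx + t * D to be used on gz; then divide by t. *)
Lemma product_increment_le (t eps N D cz cx gz gx Pz Px dv dP dc : R) :
  0 < t ->
  cx * gx + Px + t * dv - eps * (t * N) <= cz * gz + Pz ->
  `|cz - cx - t * dc| <= eps * (t * N) ->
  `|Pz - Px - t * dP| <= eps * (t * N) ->
  `|cz - cx| <= eps -> 0 <= cz -> gz <= gx + t * D ->
  dv - (dP + gx * dc) <= cx * D + eps * (`|D| + N * (2 + `|gx|)).
Proof.
move=> t0 Ez Ec EP zc cz0 gz_le; rewrite -(ler_pM2l t0).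
have cg := ler_wpM2l cz0 gz_le.
have {}EP := le_trans (ler_norm _) EP.
have {}Ec : gx * (cz - cx - t * dc) <= `|gx| * (eps * (t * N)).
  by apply: le_trans (ler_norm _) _; rewrite normrM ler_wpM2l.
have cD : (cz - cx) * (t * D) <= eps * (t * `|D|).
  apply: le_trans (ler_norm _) _; rewrite !normrM (gtr0_norm t0).
  by rewrite ler_wpM2r// mulr_ge0// ltW.
lra.
Qed.

(** Here q = <v - a, y - x>.  The convex inequality for q is scaled by cy / cx,
    and replacing cy / cx by 1 costs (cy - cx) / cx * q, which is small compared
    with r = |y - x| since q is of order r and cy - cx is small. *)
Lemma product_increment_ge (eps r m q cy cx gy gx Py Px dP dc : R) :
  0 < cx -> 0 <= cy -> q <= cx * (gy - gx) -> `|q| <= m * r ->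
  `|cy - cx| <= eps ->
  `|cy - cx - dc| <= eps * r -> `|Py - Px - dP| <= eps * r ->
  cx * gx + Px + (q + (dP + gx * dc)) - eps * ((m / cx + `|gx| + 1) * r)
    <= cy * gy + Py.
Proof.
move=> cx0 cy0 qg qm yc Ec EP.
have {}Ec : - (gx * (cy - cx - dc)) <= `|gx| * (eps * r).
  by apply: le_trans (ler_norm _) _; rewrite normrN normrM ler_wpM2l.
have {}EP : - (Py - Px - dP) <= eps * r.
  by apply: le_trans EP; rewrite -normrN ler_norm.
have cg : cy / cx * q <= cy * (gy - gx).
  apply: le_trans (ler_wpM2l _ qg) _; first by rewrite divr_ge0// ltW.
  by rewrite mulrA divfK// gt_eqF.
have cq : - ((cy - cx) / cx * q) <= eps * (m / cx * r).
  have qcx : `|q| / cx <= m / cx * r.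
    by rewrite [leRHS]mulrAC ler_pM2r// invr_gt0.
  apply: le_trans (ler_norm _) _; rewrite normrN mulrAC -mulrA normrM.
  by rewrite ler_pM// normrM normfV (gtr0_norm cx0).
have cE : (cy - cx) / cx * q = cy / cx * q - q by field; rewrite gt_eqF.
rewrite cE in cq; move: (m / cx) (cy / cx * q) cg cq => p r' cg cq; lra.
Qed.

End first_order_estimates.

Section product_rule.
Context {R : realType} {n : nat}.
Implicit Types (c g Phi F : 'rV[R]_n -> R) (X : set 'rV[R]_n).
Implicit Types (x v w : 'rV[R]_n).

Lemma diff_gradient c x w : 'd c x w = dotp (gradient c x) w.
Proof.
rewrite [in LHS](row_sum_delta w) linear_sum; apply: eq_bigr => i _.
by rewrite linearZ mxE mulrC.
Qed.

Lemma gradient_expansion c x : differentiable c x ->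
  forall e, 0 < e -> \forall y \near x,
    `|c y - c x - dotp (gradient c x) (y - x)| <= e * `|y - x|.
Proof.
move=> dc e e0; have /eqaddoP/(_ _ e0) := diff_locally dc.
move=> H; apply/nbhs0P; apply: filterS H => y.
rewrite !fctE /= diff_gradient [x + y - x]addrC addKr opprD addrA.
by rewrite [y + x]addrC.
Qed.

(** For the direct implication, test the subgradient at x + t (y - x): star
    convexity bounds the increment of g by t (g y - g x), so dividing by t and
    letting t tend to 0 turns a local inequality into one about the arbitrary
    point y of X.  For the converse, the inequality at y near x differs from the
    subgradient inequality by a first-order error. *)
Lemma regular_subdiff_product c g Phi F X x v :
  (\forall y \near x, F y = c y * g y + Phi y) ->
  differentiable c x -> differentiable Phi x -> 0 < c x -> X x ->
  (forall y t, X y -> 0 <= t -> t <= 1 ->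
    X (x + t *: (y - x)) /\ g (x + t *: (y - x)) <= g x + t * (g y - g x)) ->
  regular_subdiff (restr F X) x v <->
  forall y, X y ->
    dotp (v - (gradient Phi x + g x *: gradient c x)) (y - x)
      <= c x * (g y - g x).
Proof.
move=> HF dc dP c0 Xx conv.
have Fx := nbhs_singleton HF.
have cc := differentiable_continuous dc.
move: (gradient_expansion dc) (gradient_expansion dP).
move: (gradient c x) (gradient Phi x) => gc gP Gc GP.
split=> [/regular_subdiffP[_ H] y Xy|H].
  set d := y - x; set D := g y - g x.
  (* K is the factor of eps in the bound of product_increment_le. *)
  pose K := `|D| + norm2 d * (2 + `|g x|).
  have K0 : 0 < K + 1.
    by rewrite ltr_wpDl// addr_ge0// mulr_ge0 ?norm2_ge0 ?addr_ge0.
  apply/ler_addgt0Pr => e e0; pose eps := e / (K + 1).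
  have eps0 : 0 < eps by rewrite divr_gt0.
  have tx : (fun t : R => x + t *: d) @ 0^'+ --> x.
    rewrite -[X in _ --> X]addr0 -[in X in _ --> X](scale0r d).
    apply: cvgD; first exact: cvg_cst.
    by apply: cvgZr_tmp; exact: cvg_at_right_filter.
  have near_t : \forall t \near (0 : R)^'+, 0 < t <= 1.
    near=> t; apply/andP; split; near: t; first exact: nbhs_right_gt.
    exact: nbhs_right_le.
  have near_x : \forall z \near x,
      ((`|c z - c x| <= eps /\ 0 <= c z) /\ F z = c z * g z + Phi z) /\
      ((X z -> F x + dotp v (z - x) - eps * norm2 (z - x) <= F z) /\
       (`|c z - c x - dotp gc (z - x)| <= eps * `|z - x| /\
        `|Phi z - Phi x - dotp gP (z - x)| <= eps * `|z - x|)).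
    apply: filterI; first (apply: filterI => //; apply: filterI).
    - exact: (cvgr_distC_le _ _ cc _ eps0).
    - exact: (cvgr_ge _ cc _ c0).
    - apply: filterI; first exact: H.
      by apply: filterI; [exact: Gc|exact: GP].
  have [t [/andP[t0 t1] [[[zc cz] Fz] [Ez [Ec EP]]]]] :
    exists t, 0 < t <= 1 /\ _ := filter_ex (filterI near_t (tx _ near_x)).
  clear near_t near_x tx.
  set z := x + t *: d in zc cz Fz Ez Ec EP.
  have zx : z - x = t *: d by rewrite /z addrC addKr.
  have [Xz gz] := conv y t Xy (ltW t0) t1; rewrite -/d -/z -/D in Xz gz.
  have tN : eps * `|z - x| <= eps * (t * norm2 d).
    by rewrite zx ler_pM2l// normrZ (gtr0_norm t0) ler_pM2l// norm_le_norm2.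
  have eK : eps * K <= e.
    rewrite /eps; move: (K) K0 => k k0.
    by rewrite mulrAC ler_pdivrMr// ler_pM2l// lerDl.
  apply: le_trans (lerD (lexx _) eK); rewrite dotpBl dotpDl dotpZl.
  apply: (@product_increment_le _ t eps (norm2 d) D (c z) (c x) (g z) (g x)
    (Phi z) (Phi x)) => //.
  - by move: (Ez Xz); rewrite Fx Fz zx dotpZr norm2Z (gtr0_norm t0).
  - by apply: le_trans tN; rewrite -dotpZr -zx.
  - by apply: le_trans tN; rewrite -dotpZr -zx.
apply/regular_subdiffP; split=> // e e0.
pose a := gP + g x *: gc.
pose K := norm1 (v - a) / c x + `|g x| + 1.
have K0 : 0 < K by rewrite ltr_wpDl// addr_ge0// divr_ge0 ?norm1_ge0// ltW.
have eps0 : 0 < e / K by rewrite divr_gt0.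
have near_x : \forall y \near x,
    ((`|c y - c x| <= e / K /\ 0 <= c y) /\ F y = c y * g y + Phi y) /\
    (`|c y - c x - dotp gc (y - x)| <= e / K * `|y - x| /\
     `|Phi y - Phi x - dotp gP (y - x)| <= e / K * `|y - x|).
  apply: filterI; first (apply: filterI => //; apply: filterI).
  - exact: (cvgr_distC_le _ _ cc _ eps0).
  - exact: (cvgr_ge _ cc _ c0).
  - by apply: filterI; [exact: Gc|exact: GP].
apply: filterS near_x => y [[[cyx cy] Fy] [Ec EP]] Xy.
have {}H := H _ Xy; rewrite -/a in H.
have eN : e / K * (K * `|y - x|) <= e * norm2 (y - x).
  by rewrite mulrA divfK ?gt_eqF// ler_pM2l// norm_le_norm2.
have -> : dotp v (y - x) = dotp (v - a) (y - x) +
    (dotp gP (y - x) + g x * dotp gc (y - x)).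
  by rewrite -dotpZl -!dotpDl subrK.
apply: le_trans (lerB (lexx _) eN) _; rewrite Fx Fy.
apply: (@product_increment_ge _ _ `|y - x| (norm1 (v - a))
  (dotp (v - a) (y - x)) (c y) (c x) (g y) (g x) (Phi y) (Phi x)) => //.
exact: dotp_le.
Unshelve. all: by end_near. Qed.

End product_rule.

(** * The gradient of the inverse norm *)
Section gradients.
Context {R : realType} {n : nat}.
Implicit Types (f c : 'rV[R]_n -> R) (x v w : 'rV[R]_n).

Lemma dotp_is_linear v : linear (dotp v).
Proof. by move=> a x y; rewrite dotpDr dotpZr. Qed.

HB.instance Definition _ v :=
  GRing.isLinear.Build R 'rV[R]_n R *:%R (dotp v) (dotp_is_linear v).

Lemma continuous_dotp v : continuous (dotp v).
Proof.
move=> x; apply: (cvg_dotp (F := nbhs x) (f := fun=> v) (g := id)) => //.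
exact: cvg_cst.
Qed.

Lemma differentiable_dotp v x : differentiable (dotp v) x.
Proof. exact/linear_differentiable/continuous_dotp. Qed.

Lemma is_derive_dotp v x w : is_derive x w (dotp v) (dotp v w).
Proof.
have dv := differentiable_dotp v x.
apply: DeriveDef; first exact: diff_derivable.
by rewrite deriveE// diff_lin//; exact: continuous_dotp.
Qed.

Lemma gradient_is_derive f x w : differentiable f x ->
  (forall v, is_derive x v f (dotp w v)) -> gradient f x = w.
Proof.
move=> df fw; apply/rowP => i; rewrite mxE -deriveE// -dotp_delta.
by have [_ ->] := fw (delta_mx 0 i).
Qed.

Let sumsq : 'rV[R]_n -> R := \sum_(i < n) dotp (delta_mx 0 i) ^+ 2.

Let sumsqE x : sumsq x = \sum_(i < n) x 0 i ^+ 2.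
Proof.
rewrite /sumsq fct_sumE; apply: eq_bigr => i _.
by rewrite exprfctE dotpC dotp_delta.
Qed.

Let norm2E : norm2 = Num.sqrt \o sumsq.
Proof. by apply/funext => x /=; rewrite sumsqE. Qed.

Let sumsq_gt0 x : x != 0 -> 0 < sumsq x.
Proof. by move=> /norm2_gt0; rewrite norm2E sqrtr_gt0. Qed.

Let differentiable_sumsq x : differentiable sumsq x.
Proof.
apply: differentiable_sum => i; apply: differentiableX.
exact: differentiable_dotp.
Qed.

Let differentiable_sqrt (s : R) : 0 < s -> differentiable Num.sqrt s.
Proof. by move=> s0; apply/derivable1_diffP; case: (is_derive1_sqrt s0). Qed.

Lemma differentiable_norm2 x : x != 0 -> differentiable norm2 x.
Proof.
move=> x0; rewrite norm2E; apply: differentiable_comp => //.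
exact/differentiable_sqrt/sumsq_gt0.
Qed.

Lemma is_derive_norm2 x v : x != 0 ->
  is_derive x v norm2 ((norm2 x)^-1 * dotp x v).
Proof.
move=> x0; have dN := differentiable_norm2 x0.
apply: DeriveDef; first exact: diff_derivable.
have s0 := sumsq_gt0 x0; have [ds Ds] := is_derive1_sqrt s0.
rewrite deriveE// norm2E diff_comp//; last exact: differentiable_sqrt.
rewrite /= deriv1E// derive1E Ds -deriveE//.
have dh i : is_derive x v (dotp (delta_mx 0 i) ^+ 2)
    ((2 * dotp (delta_mx 0 i) x) *: dotp (delta_mx 0 i) v).
  exact: (is_deriveX 2 (is_derive_dotp (delta_mx 0 i) x v)).
have [_ ->] := is_derive_sum dh.
rewrite (_ : \sum_(i < n) _ = 2 * dotp x v); last first.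
  rewrite mulr_sumr; apply: eq_bigr => i _.
  by rewrite ![dotp (delta_mx _ _) _]dotpC !dotp_delta /GRing.scale/= mulrA.
rewrite /GRing.scale/=; field.
by rewrite sqrtr_eq0 -ltNge.
Qed.

Lemma differentiable_inv_norm2 (gamma : R) x : x != 0 ->
  differentiable (fun y => gamma / norm2 y) x.
Proof.
move=> x0; have nx : norm2 x != 0 by rewrite gt_eqF// norm2_gt0.
apply: differentiableZ; apply: differentiableV => //.
exact: differentiable_norm2.
Qed.

Lemma gradient_inv_norm2 (gamma : R) x : x != 0 ->
  gradient (fun y => gamma / norm2 y) x = - (gamma / norm2 x ^+ 3) *: x.
Proof.
move=> x0; have nx : norm2 x != 0 by rewrite gt_eqF// norm2_gt0.
apply: gradient_is_derive => [|v]; first exact: differentiable_inv_norm2.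
have [dN DN] := is_derive_norm2 v x0.
have dV := derivableV nx dN.
apply: DeriveDef; first by apply: derivableZ; exact: dV.
have -> : 'D_v (fun y => gamma / norm2 y) x =
    gamma *: 'D_v (fun y => (norm2 y)^-1) x by exact: deriveZ.
rewrite (deriveV nx dN) DN dotpZl /GRing.scale/=; field.
exact: nx.
Qed.

End gradients.

(** * Subdifferentials of the objective away from the origin *)
Section general_subdifferentials.
Context {R : realType} {n : nat}.
Implicit Types (h : 'rV[R]_n -> \bar R) (x v w : 'rV[R]_n).

Lemma regular_sub_limiting h x : regular_subdiff h x `<=` limiting_subdiff h x.
Proof.
move=> v hv; split; first by case: hv.
by exists (fun=> x), (fun=> v); split => //; exact: cvg_cst.
Qed.

(** With v a subgradient, so is v + (r + 1) w for each r; scaled by 1 / (r + 1)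
    these tend to w. *)
Lemma recession_sub_horizon h x : regular_subdiff h x !=set0 ->
  recession_cone (regular_subdiff h x) `<=` horizon_subdiff h x.
Proof.
move=> [v hv] w hw; split; first by case: hv.
exists (fun=> x), (fun r => v + r.+1%:R *: w), (fun r => r.+1%:R^-1); split.
- by split; exact: cvg_cst.
- by move=> r; apply: regular_sub_limiting; exact: hw.
- by split => [r|]; [rewrite invr_gt0|exact: cvg_harmonic].
- have lim_w : r.+1%:R^-1 *: v + w @[r --> \oo] --> 0 *: v + w.
    by apply: cvgD; [apply: cvgZr_tmp; exact: cvg_harmonic|exact: cvg_cst].
  rewrite scale0r add0r in lim_w; apply: cvg_trans lim_w.
  apply: near_eq_cvg; apply: nearW => r.
  by rewrite scalerDr scalerA mulVf ?pnatr_eq0// scale1r.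
Qed.

End general_subdifferentials.

Section ratio_subdifferentials.
Context {R : realType} {n : nat}.
Variables (X : set 'rV[R]_n) (gamma : R) (Phi : 'rV[R]_n -> R).
Hypothesis closedX : closed X.
Hypothesis convexX : forall x y (t : R), X x -> X y -> 0 <= t -> t <= 1 ->
  X (x + t *: (y - x)).
Hypothesis gamma0 : 0 < gamma.
Hypothesis smoothPhi : smooth_fun setT Phi.
Implicit Types (x y v w : 'rV[R]_n).

Let c y := gamma / norm2 y.
Let F := Fu gamma Phi.

(** The part of the product rule that differentiates Phi and the coefficient c,
    common to all subgradients at x. *)
Definition base_gradient x := gradient Phi x + norm1 x *: gradient c x.

Lemma FuE x : x != 0 -> F x = c x * norm1 x + Phi x.
Proof. by move=> /negPf x0; rewrite /F /Fu /ratio12 x0 /c mulrA mulrAC. Qed.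

Lemma near_neq0 x : x != 0 -> \forall y \near x, y != 0.
Proof. by move=> x0; apply: (cvgr_neq0 _ (@cvg_id _ (nbhs x))). Qed.

Lemma coef_gt0 x : x != 0 -> 0 < c x.
Proof. by move=> x0; rewrite divr_gt0// norm2_gt0. Qed.

Lemma norm1_segment x y t : 0 <= t -> t <= 1 ->
  norm1 (x + t *: (y - x)) <= norm1 x + t * (norm1 y - norm1 x).
Proof.
move=> t0 t1; have -> : x + t *: (y - x) = (1 - t) *: x + t *: y.
  by rewrite scalerBr scalerBl scale1r addrCA addrC.
apply: le_trans (norm1D _ _) _; rewrite !norm1Z (ger0_norm t0).
by rewrite ger0_norm ?subr_ge0//; lra.
Qed.

Lemma regular_subdiff_Fu x v : x != 0 ->
  regular_subdiff (restr F X) x v <->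
  X x /\ forall y, X y ->
    dotp (v - base_gradient x) (y - x) <= c x * (norm1 y - norm1 x).
Proof.
move=> x0.
have H (Xx : X x) : regular_subdiff (restr F X) x v <-> forall y, X y ->
    dotp (v - base_gradient x) (y - x) <= c x * (norm1 y - norm1 x).
  refine (@regular_subdiff_product _ _ c norm1 Phi F X x v
    _ _ _ (coef_gt0 x0) Xx _).
  - by apply: filterS (near_neq0 x0) => y; exact: FuE.
  - exact: differentiable_inv_norm2.
  - by case: smoothPhi => + _; apply.
  - by move=> y t Xy t0 t1; split; [exact: convexX|exact: norm1_segment].
split=> [rv|[Xx]]; last by move/H; apply.
have [Xx _] := (regular_subdiffP _ _ _ _).1 rv.
by split=> //; apply/H.
Qed.

Let gradient_c x : x != 0 -> gradient c x = - (gamma / norm2 x ^+ 3) *: x.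
Proof. exact: gradient_inv_norm2. Qed.

Lemma gradient_continuous : continuous (gradient Phi).
Proof.
case: smoothPhi => _ lipPhi x.
have [k [k0 lipk]] : exists k, 0 < k /\ k.-lipschitz (gradient Phi).
  near (+oo : set_system R) => k; exists k; split; near: k => //.
  exact: nbhs_pinfty_gt.
apply/(cvgrPdist_le (F := nbhs x)) => e e0; near=> y.
apply: le_trans (lipk (x, y) _) _ => //=.
rewrite mulrC -ler_pdivlMr//; near: y.
by apply: (cvgr_dist_le _ _ (@cvg_id _ (nbhs x))); rewrite divr_gt0.
Unshelve. all: by end_near. Qed.

Lemma continuous_coef x : x != 0 -> {for x, continuous c}.
Proof.
by move=> x0; apply: differentiable_continuous; exact: differentiable_inv_norm2.
Qed.

Lemma base_gradient_continuous x : x != 0 -> {for x, continuous base_gradient}.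
Proof.
move=> x0; have nN : norm2 x != 0 by rewrite gt_eqF// norm2_gt0.
have gc : gradient c @ x --> gradient c x.
  rewrite gradient_c//.
  apply: (@cvg_trans _ ((fun y => - (gamma / norm2 y ^+ 3) *: y) @ x)).
    apply: (near_eq_cvg (F := nbhs x)); apply: filterS (near_neq0 x0) => y y0.
    by rewrite gradient_c.
  apply: (cvgZ (F := nbhs x) (f := id)) => //.
  apply: (cvgN (F := nbhs x)).
  apply: (cvgM (F := nbhs x)); first exact: cvg_cst.
  apply: (cvgV (F := nbhs x)); first by rewrite expf_neq0.
  apply: (@continuous_cvg _ _ _ (nbhs x) _ norm2 (fun r : R => r ^+ 3)).
    exact: exprn_continuous.
  exact: continuous_norm2.
apply: (cvgD (F := nbhs x) (f := gradient Phi)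
  (g := fun y => norm1 y *: gradient c y)); first exact: gradient_continuous.
by apply: (cvgZ (F := nbhs x) (f := gradient c)) => //; exact: continuous_norm1.
Qed.

(** Closedness of the graph: each of the inequalities characterizing
    subgradients is continuous in the point and in the subgradient. *)
Lemma regular_subdiff_Fu_closed (xr vr : nat -> 'rV[R]_n) x v : x != 0 ->
  xr r @[r --> \oo] --> x -> vr r @[r --> \oo] --> v ->
  (\forall r \near \oo, regular_subdiff (restr F X) (xr r) (vr r)) ->
  regular_subdiff (restr F X) x v.
Proof.
move=> x0 xrx vrv rv.
have {}rv : \forall r \near \oo, X (xr r) /\ forall y, X y ->
    dotp (vr r - base_gradient (xr r)) (y - xr r) <=
      c (xr r) * (norm1 y - norm1 (xr r)).
  have xr0 : \forall r \near \oo, xr r != 0 by exact: xrx (near_neq0 x0).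
  by apply: filterS2 xr0 rv => r r0; case/(regular_subdiff_Fu _ r0).
apply/(regular_subdiff_Fu _ x0); split.
  by apply: (closed_cvg _ closedX) xrx; apply: filterS rv => r [].
move=> y Xy.
have brb : base_gradient (xr r) @[r --> \oo] --> base_gradient x.
  by apply: continuous_cvg xrx; exact: base_gradient_continuous.
have crc : c (xr r) @[r --> \oo] --> c x.
  by apply: continuous_cvg xrx; exact: continuous_coef.
have nrn : norm1 (xr r) @[r --> \oo] --> norm1 x.
  by apply: continuous_cvg xrx; exact: continuous_norm1.
apply: (@ler_cvg_to _ _ _ _ _ _ _ _
  (cvg_dotp (cvgB vrv brb) (cvgB (cvg_cst y) xrx))
  (cvgM crc (cvgB (cvg_cst (norm1 y)) nrn))).
by apply: filterS rv => r [_ /(_ _ Xy)].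
Qed.

Lemma limiting_subdiff_Fu x : x != 0 ->
  limiting_subdiff (restr F X) x = regular_subdiff (restr F X) x.
Proof.
move=> x0; apply/seteqP; split; last exact: regular_sub_limiting.
move=> v [_ [xr [vr [xrx _ rv vrv]]]].
by apply: regular_subdiff_Fu_closed xrx vrv _ => //; exact: nearW.
Qed.

(** Scaling the inequalities at x^r by lam_r, which tends to 0, removes both the
    base gradient and the increment of norm1, leaving w in the normal cone of X
    at x; adding a multiple of w then preserves the inequalities at x. *)
Lemma horizon_subdiff_Fu x : x != 0 -> regular_subdiff (restr F X) x !=set0 ->
  horizon_subdiff (restr F X) x =
    recession_cone (regular_subdiff (restr F X) x).
Proof.
move=> x0 rx0; apply/seteqP; split; last exact: recession_sub_horizon.
move=> w [_ [xr [vr [lam [[xrx _] rv [lam0 lamc] lvw]]]]] v t.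
move=> /(regular_subdiff_Fu _ x0)[Xx Hv] t0.
apply/(regular_subdiff_Fu _ x0); split=> // y Xy.
suff w0 : dotp w (y - x) <= 0.
  rewrite addrAC dotpDl dotpZl; have := Hv _ Xy.
  have := mulr_ge0_le0 t0 w0; lra.
have brb : base_gradient (xr r) @[r --> \oo] --> base_gradient x.
  by apply: continuous_cvg xrx; exact: base_gradient_continuous.
have crc : c (xr r) @[r --> \oo] --> c x.
  by apply: continuous_cvg xrx; exact: continuous_coef.
have nrn : norm1 (xr r) @[r --> \oo] --> norm1 x.
  by apply: continuous_cvg xrx; exact: continuous_norm1.
have lhs : dotp (lam r *: vr r - lam r *: base_gradient (xr r)) (y - xr r)
    @[r --> \oo] --> dotp (w - 0 *: base_gradient x) (y - x).
  by apply: cvg_dotp; apply: cvgB => //; [exact: cvgZ|exact: cvg_cst].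
have rhs : lam r * (c (xr r) * (norm1 y - norm1 (xr r))) @[r --> \oo] -->
    0 * (c x * (norm1 y - norm1 x)).
  by apply: cvgM => //; apply: cvgM => //; apply: cvgB => //; exact: cvg_cst.
rewrite scale0r subr0 in lhs; rewrite mul0r in rhs; apply: (ler_cvg_to lhs rhs).
have xr0 : \forall r \near \oo, xr r != 0 by exact: xrx (near_neq0 x0).
apply: filterS xr0 => r r0; have := rv r; rewrite limiting_subdiff_Fu//.
move=> /(regular_subdiff_Fu _ r0)[_ /(_ _ Xy)].
by rewrite -(ler_pM2l (lam0 r)) -dotpZl scalerBr.
Qed.

Lemma closed_sublevel (f : 'rV[R]_n -> R) (r : R) :
  continuous f -> closed [set z | f z <= r].
Proof.
by move=> fc; exact: ((continuous_closedP f).1 fc _ (@closed_le _ r)).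
Qed.

(** Only the discontinuity of the ratio at 0 is in the way: on a closed ball
    that avoids 0, multiplying F z <= a by norm2 z gives an inequality between
    functions that are continuous everywhere. *)
Lemma locally_lsc_Fu x : x != 0 -> X x -> locally_lsc (restr F X) x.
Proof.
move=> x0 Xx; split; first by rewrite restr_in.
have Nx := norm2_gt0 x0.
exists (norm2 x / 2) => [|a _]; first by rewrite divr_gt0.
rewrite (_ : mkset _ = [set z | norm2 (z - x) <= norm2 x / 2] `&` X `&`
    [set z | gamma * norm1 z + (Phi z - a) * norm2 z <= 0]); last first.
  have key z : norm2 (z - x) <= norm2 x / 2 -> X z ->
      (restr F X z <= a%:E)%E = (gamma * norm1 z + (Phi z - a) * norm2 z <= 0).
    move=> zx Xz; have z0 : z != 0.
      apply/eqP => z0; move: zx.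
      rewrite z0 sub0r -scaleN1r norm2Z normrN1 mul1r; lra.
    have Nz := norm2_gt0 z0; rewrite restr_in// lee_fin FuE//.
    rewrite -(ler_pM2r Nz) mulrDl {1}/c mulrAC divfK ?gt_eqF//.
    by rewrite -subr_le0 mulrBl addrA.
  apply/seteqP; split=> z /= => [[zx za]|[[zx Xz]]]; last by rewrite -key.
  have Xz : X z by apply: contrapT => Xz; move: za; rewrite restr_out.
  by split=> //; rewrite -key.
apply: closedI; first apply: closedI => //.
- apply: (closed_sublevel (f := fun z => norm2 (z - x))) => z.
  apply: (@continuous_cvg _ _ _ (nbhs z) _ (fun z => z - x)).
    exact: continuous_norm2.
  by apply: (cvgB (F := nbhs z)); [exact: cvg_id|exact: cvg_cst].
- apply: (closed_sublevel
    (f := fun z => gamma * norm1 z + (Phi z - a) * norm2 z)) => z.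
  apply: (cvgD (F := nbhs z)).
    by apply: (cvgM (F := nbhs z)); [exact: cvg_cst|exact: continuous_norm1].
  apply: (cvgM (F := nbhs z)); last exact: continuous_norm2.
  apply: (cvgB (F := nbhs z)); last exact: cvg_cst.
  by apply: differentiable_continuous; case: smoothPhi => + _; apply.
Qed.

Lemma regular_at_Fu x : x != 0 -> X x -> regular_subdiff (restr F X) x !=set0 ->
  regular_at (restr F X) x.
Proof.
move=> x0 Xx rx; split; first exact: locally_lsc_Fu.
  exact: limiting_subdiff_Fu.
exact: horizon_subdiff_Fu.
Qed.

End ratio_subdifferentials.

(** * Bounded Lipschitz functions and restricted smoothness *)
Section bounded_lipschitz.
Context {R : realType} {n : nat}.
Variable A : set 'rV[R]_n.
Implicit Types (f g : 'rV[R]_n -> R) (x y : 'rV[R]_n).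

(** One constant for the bound and the Lipschitz estimate; boundedness is what
    makes products of Lipschitz functions Lipschitz. *)
Definition bdd_lipschitz f :=
  exists K, [/\ 0 <= K, (forall x, A x -> `|f x| <= K) &
  forall x y, A x -> A y -> `|f x - f y| <= K * `|x - y|].

Lemma eq_bdd_lipschitz f g : (forall x, A x -> f x = g x) ->
  bdd_lipschitz f -> bdd_lipschitz g.
Proof.
move=> fg [K [K0 fK fL]]; exists K; split=> // [x Ax|x y Ax Ay].
  by rewrite -fg//; exact: fK.
by rewrite -!fg//; exact: fL.
Qed.

Lemma bdd_lipschitz_cst (k : R) : bdd_lipschitz (fun=> k).
Proof. by exists `|k|; split=> // x y _ _; rewrite subrr normr0 mulr_ge0. Qed.

Lemma bdd_lipschitzD f g : bdd_lipschitz f -> bdd_lipschitz g ->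
  bdd_lipschitz (fun x => f x + g x).
Proof.
move=> [K [K0 fK fL]] [L [L0 gL gLL]].
exists (K + L); split=> [|x Ax|x y Ax Ay].
- exact: addr_ge0.
- by apply: le_trans (ler_normD _ _) _; apply: lerD; [exact: fK|exact: gL].
- rewrite opprD addrACA mulrDl; apply: le_trans (ler_normD _ _) _.
  by apply: lerD; [exact: fL|exact: gLL].
Qed.

Lemma bdd_lipschitzM f g : bdd_lipschitz f -> bdd_lipschitz g ->
  bdd_lipschitz (fun x => f x * g x).
Proof.
move=> [K [K0 fK fL]] [L [L0 gL gLL]].
have KL0 : 0 <= K * L by exact: mulr_ge0.
exists (K * L + K * L); split=> [|x Ax|x y Ax Ay].
- exact: addr_ge0.
- rewrite normrM (@le_trans _ _ (K * L))// ?lerDl//.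
  by apply: ler_pM => //; [exact: fK|exact: gL].
have -> : f x * g x - f y * g y = f x * (g x - g y) + (f x - f y) * g y by ring.
rewrite [leRHS]mulrDl; apply: le_trans (ler_normD _ _) _; rewrite !normrM.
apply: lerD; first by rewrite -mulrA ler_pM//; [exact: fK|exact: gLL].
by rewrite mulrAC ler_pM//; [exact: fL|exact: gL].
Qed.

Lemma bdd_lipschitz_sum m (f : 'I_m -> 'rV[R]_n -> R) :
  (forall i, bdd_lipschitz (f i)) ->
  bdd_lipschitz (fun x => \sum_(i < m) f i x).
Proof.
elim: m f => [|m IH] f fL.
  by apply: eq_bdd_lipschitz (bdd_lipschitz_cst 0) => x _; rewrite big_ord0.
apply: eq_bdd_lipschitz
  (bdd_lipschitzD (IH (fun i => f (widen_ord (leqnSn m) i)) _) (fL ord_max)).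
  by move=> x _; rewrite big_ord_recr.
by move=> i; exact: fL.
Qed.

Lemma bdd_lipschitz_coord (B : R) : (forall x, A x -> `|x| <= B) ->
  forall i, bdd_lipschitz (fun x => x 0 i).
Proof.
move=> AB i; exists (`|B| + 1).
split=> [|x Ax|x y Ax Ay]; first exact: addr_ge0.
- rewrite (le_trans (coord_le_norm x i))// (le_trans (AB _ Ax))//.
  by rewrite (le_trans (ler_norm B))// lerDl.
- have := coord_le_norm (x - y) i; rewrite !mxE => /le_trans; apply.
  by rewrite ler_peMl// lerDr.
Qed.

Lemma bdd_lipschitz_inv (m : R) f : 0 < m -> (forall x, A x -> m <= f x) ->
  bdd_lipschitz f -> bdd_lipschitz (fun x => (f x)^-1).
Proof.
move=> m0 fm [K [K0 fK fL]].
have f0 x : A x -> 0 < f x by move=> Ax; exact: lt_le_trans (fm _ Ax).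
have fV x : A x -> `|(f x)^-1| <= m^-1.
  by move=> Ax; rewrite gtr0_norm ?invr_gt0 ?f0// lef_pV2 ?posrE ?f0// fm.
have mV : 0 <= m^-1 by rewrite invr_ge0 ltW.
have KV : 0 <= K * (m^-1 * m^-1) by rewrite !mulr_ge0.
exists (m^-1 + K * (m^-1 * m^-1)).
split=> [|x Ax|x y Ax Ay]; first exact: addr_ge0.
  by rewrite (le_trans (fV _ Ax))// lerDl.
have -> : (f x)^-1 - (f y)^-1 = (f y - f x) * ((f x)^-1 * (f y)^-1).
  by field; rewrite !gt_eqF ?f0.
rewrite normrM distrC (@le_trans _ _ (K * (m^-1 * m^-1) * `|x - y|))//.
  by rewrite mulrAC ler_pM// ?fL// normrM ler_pM// fV.
by rewrite ler_wpM2r// lerDr.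
Qed.

Lemma bdd_lipschitz_sqrt (m : R) f : 0 < m -> (forall x, A x -> m <= f x) ->
  bdd_lipschitz f -> bdd_lipschitz (fun x => Num.sqrt (f x)).
Proof.
move=> m0 fm [K [K0 fK fL]].
have f0 x : A x -> 0 < f x by move=> Ax; exact: lt_le_trans (fm _ Ax).
have s0 : 0 < Num.sqrt m by rewrite sqrtr_gt0.
have sf x : A x -> Num.sqrt m <= Num.sqrt (f x).
  by move=> Ax; rewrite ler_wsqrtr// fm.
have KV : 0 <= K / Num.sqrt m by rewrite divr_ge0// ltW.
exists (Num.sqrt K + K / Num.sqrt m); split=> [|x Ax|x y Ax Ay].
- by rewrite addr_ge0// sqrtr_ge0.
- rewrite ger0_norm ?sqrtr_ge0// (@le_trans _ _ (Num.sqrt K)) ?lerDl//.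
  by rewrite ler_wsqrtr// (le_trans (ler_norm _))// fK.
have sxy : Num.sqrt m <= Num.sqrt (f x) + Num.sqrt (f y).
  by rewrite (le_trans (sf _ Ax))// lerDl sqrtr_ge0.
have -> : Num.sqrt (f x) - Num.sqrt (f y) =
    (f x - f y) / (Num.sqrt (f x) + Num.sqrt (f y)).
  rewrite -(sqr_sqrtr (ltW (f0 _ Ax))) -(sqr_sqrtr (ltW (f0 _ Ay))).
  rewrite !sqrtr_sqr !ger0_norm ?sqrtr_ge0// subr_sqr mulfK//.
  by rewrite gt_eqF// (lt_le_trans s0).
rewrite (@le_trans _ _ (K / Num.sqrt m * `|x - y|))//; last first.
  by rewrite ler_wpM2r// lerDr sqrtr_ge0.
rewrite normrM mulrAC ler_pM// ?fL// gtr0_norm ?invr_gt0 ?(lt_le_trans s0)//.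
by rewrite lef_pV2 ?posrE// (lt_le_trans s0).
Qed.

Lemma lipschitz_le (W : normedModType R) (f : 'rV[R]_n -> W) (K : R) :
  (forall x y, A x -> A y -> `|f x - f y| <= K * `|x - y|) ->
  [lipschitz f x | x in A].
Proof.
move=> fK; exists K; split; first exact: num_real.
move=> M KM [x y] [/= Ax Ay]; apply: le_trans (fK _ _ Ax Ay) _.
by rewrite ler_wpM2r// ltW.
Qed.

Lemma bdd_lipschitz_row m (f : 'rV[R]_n -> 'rV[R]_m) :
  (forall i, bdd_lipschitz (fun x => f x 0 i)) ->
  exists K, forall x y, A x -> A y -> `|f x - f y| <= K * `|x - y|.
Proof.
move=> /choice[K fK]; exists (\sum_(i < m) K i) => x y Ax Ay.
have K0 i : 0 <= K i by case: (fK i).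
apply: norm_le_coords => [|i]; first by rewrite mulr_ge0// sumr_ge0.
rewrite !mxE; case: (fK i) => _ _ /(_ _ _ Ax Ay) /le_trans; apply.
by rewrite ler_wpM2r// (bigD1 i)//= lerDl sumr_ge0.
Qed.

End bounded_lipschitz.

Section restricted_smoothness.
Context {R : realType} {n : nat}.
Implicit Types (f g : 'rV[R]_n -> R) (x y v : 'rV[R]_n).

Lemma gradientD f g x : differentiable f x -> differentiable g x ->
  gradient (fun y => f y + g y) x = gradient f x + gradient g x.
Proof.
move=> df dg; apply/rowP => i; rewrite !mxE.
exact: (congr1 (fun h => h (delta_mx 0 i)) (diffD df dg)).
Qed.

Lemma gradientM f g x : differentiable f x -> differentiable g x ->
  gradient (fun y => f y * g y) x = f x *: gradient g x + g x *: gradient f x.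
Proof.
move=> df dg; apply/rowP => i; rewrite !mxE.
exact: (congr1 (fun h => h (delta_mx 0 i)) (diffM df dg)).
Qed.

Lemma gradient_dotp v x : gradient (dotp v) x = v.
Proof.
apply: gradient_is_derive => [|w]; first exact: differentiable_dotp.
exact: is_derive_dotp.
Qed.

(** The bound on the radius makes norm2 at least |x0| / 2 on the ball, which is
    bounded; there the coordinates of the gradient are built from coordinates
    and the inverse norm by sums and products. *)
Lemma smooth_linear_over_norm2 (gamma r : R) (Phi : 'rV[R]_n -> R) v x0 :
  smooth_fun setT Phi -> x0 != 0 -> r <= `|x0| / 2 ->
  smooth_fun (ball x0 r) (fun y => gamma / norm2 y * dotp v y + Phi y).
Proof.
move=> [dPhi lipPhi] x00 rx.
have n0 : 0 < `|x0| by rewrite normr_gt0.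
have far y : ball x0 r y -> `|x0| / 2 <= `|y|.
  rewrite -ball_normE /= => xy; have := ler_distD y x0 0.
  rewrite !subr0; lra.
have near_bound y : ball x0 r y -> `|y| <= 2 * `|x0|.
  rewrite -ball_normE /= => xy; have := ler_distD x0 y 0.
  rewrite !subr0 distrC; lra.
have y0 y : ball x0 r y -> y != 0.
  by move=> /far; rewrite -normr_gt0; apply: lt_le_trans; rewrite divr_gt0.
have dc y : ball x0 r y -> differentiable (fun y => gamma / norm2 y) y.
  by move=> /y0; exact: differentiable_inv_norm2.
have dcv y : ball x0 r y ->
    differentiable (fun y => gamma / norm2 y * dotp v y) y.
  by move=> By; apply: differentiableM; [exact: dc|exact: differentiable_dotp].
split=> [y By|]; first by apply: differentiableD; [exact: dcv|exact: dPhi].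
have [k lipk] : exists k, k.-lipschitz (gradient Phi).
  by near (+oo : set_system R) => k; exists k; near: k.
have gE y : ball x0 r y ->
    gradient (fun y => gamma / norm2 y * dotp v y + Phi y) y =
    ((gamma / norm2 y) *: v + dotp v y *: (- (gamma / norm2 y ^+ 3) *: y)) +
    gradient Phi y.
  move=> By; rewrite gradientD; [|exact: dcv|exact: dPhi].
  rewrite gradientM; [|exact: dc|exact: differentiable_dotp].
  by rewrite gradient_dotp gradient_inv_norm2// y0.
have coord := bdd_lipschitz_coord near_bound.
have bdd_lipschitzN : bdd_lipschitz (ball x0 r) (fun y => (norm2 y)^-1).
  have m0 : 0 < `|x0| / 2 by rewrite divr_gt0.
  apply: (bdd_lipschitz_inv m0) => [y By|].
    by rewrite (le_trans (far _ By))// norm_le_norm2.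
  apply: (@bdd_lipschitz_sqrt _ _ _ ((`|x0| / 2) ^+ 2)) => [|y By|].
  - by rewrite exprn_gt0.
 
 - rewrite -sqr_norm2 ler_sqr ?nnegrE ?norm2_ge0 ?(ltW m0)//.
    exact: le_trans (far _ By) (norm_le_norm2 _).
  - by apply: bdd_lipschitz_sum => i; apply: bdd_lipschitzM.
have bdd_lipschitzd : bdd_lipschitz (ball x0 r) (dotp v).
  apply: bdd_lipschitz_sum => i; apply: bdd_lipschitzM => //.
  exact: bdd_lipschitz_cst.
have [K lipK] : exists K, forall x y, ball x0 r x -> ball x0 r y ->
  `|((gamma / norm2 x) *: v + dotp v x *: (- (gamma / norm2 x ^+ 3) *: x)) -
    ((gamma / norm2 y) *: v + dotp v y *: (- (gamma / norm2 y ^+ 3) *: y))|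
    <= K * `|x - y|.
  apply: (bdd_lipschitz_row (f := fun y => (gamma / norm2 y) *: v +
    dotp v y *: (- (gamma / norm2 y ^+ 3) *: y))) => i.
  pose h y := gamma * (norm2 y)^-1 * v 0 i + dotp v y *
    (- gamma * ((norm2 y)^-1 * ((norm2 y)^-1 * (norm2 y)^-1)) * y 0 i).
  apply: (@eq_bdd_lipschitz _ _ _ h) => [y _|].
    by rewrite /h !mxE !exprS expr0 mulr1 !invfM mulNr.
  by do !(apply: bdd_lipschitzD || apply: bdd_lipschitzM ||
    apply: bdd_lipschitz_cst || done).
apply: (@lipschitz_le _ _ _ _ _ (K + k)) => x y Bx By.
rewrite !gE// opprD addrACA mulrDl (le_trans (ler_normD _ _))// lerD// ?lipK//.
exact: (lipk (x, y)).
Unshelve. all: by end_near. Qed.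

End restricted_smoothness.

(** * The manifold of vectors with a given support *)
Section support_manifold.
Context {R : realType} {n : nat}.
Variable x0 : 'rV[R]_n.
Implicit Types (x y z w : 'rV[R]_n).

Let off_supp (k : 'I_#|~: supp x0|) : 'I_n := enum_val k.
(* The local equation keeps the coordinates off the support of x0; on the open
   set V the coordinates on the support cannot vanish. *)
Let Psi := fun z : 'rV[R]_n => colsub off_supp z.
Let V := [set z : 'rV[R]_n | forall i, x0 0 i != 0 -> z 0 i != 0].

Lemma in_supp x i : (i \in supp x) = (x 0 i != 0).
Proof. by rewrite inE. Qed.

Let off_suppP k : x0 0 (off_supp k) = 0.
Proof. by apply/eqP; have := enum_valP k; rewrite inE in_supp negbK. Qed.

Let continuous_Psi : continuous Psi.
Proof.
move=> x; apply/(cvgrPdist_le (F := nbhs x)) => e e0; near=> y.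
have Psi_le : `|Psi (x - y)| <= `|x - y|.
  apply: norm_le_coords => // k; rewrite !mxE.
  by have := coord_le_norm (x - y) (off_supp k); rewrite !mxE.
rewrite -linearB/=; apply: le_trans Psi_le _; near: y.
exact: (cvgr_dist_le _ _ (@cvg_id _ (nbhs x)) _ e0).
Unshelve. all: by end_near. Qed.

Let differentiable_Psi z : differentiable Psi z.
Proof. exact: linear_differentiable continuous_Psi. Qed.

Let diff_Psi z : 'd Psi z = Psi :> (_ -> _).
Proof. exact: diff_lin continuous_Psi. Qed.

Let open_V : open V.
Proof.
rewrite openE => z Vz; rewrite /interior.
apply: (filter_forall (F := nbhs z)
  (f := fun i (y : 'rV[R]_n) => x0 0 i != 0 -> y 0 i != 0)) => i.
have [x0i|x0i] := boolP (x0 0 i == 0); first by apply: nearW.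
have yz : (fun y : 'rV[R]_n => y 0 i) @ z --> z 0 i by exact: coord_continuous.
by apply: filterS (cvgr_neq0 _ yz (Vz _ x0i)) => y.
Qed.

Lemma support_local_equation : local_equation (same_supp x0) x0 V Psi.
Proof.
split=> //.
- split=> [z _|]; first exact: differentiable_Psi.
  apply: (@lipschitz_le _ _ _ _ _ 0) => x y _ _.
  have JE z : 'J Psi z = lin1_mx Psi by congr (lin1_mx _); exact: diff_Psi.
  by rewrite !JE subrr normr0 mul0r.
- move=> z _; rewrite (diff_Psi z) => u _.
  exists (\sum_k u 0 k *: delta_mx 0 (off_supp k)) => //.
  apply/rowP => k; rewrite /Psi mxE summxE (bigD1 k)//= big1 ?addr0 => [|j jk].
    by rewrite !mxE !eqxx mulr1.
  rewrite !mxE eqxx/= [_ == _](_ : _ = false) ?mulr0//.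
  by apply/negbTE; rewrite eq_sym; apply: contra jk => /eqP/enum_val_inj ->.
- apply/seteqP; split=> z /= [].
    move=> /setP Mz Vz; split=> //; apply/rowP => k; rewrite !mxE.
    by have := Mz (off_supp k); rewrite !in_supp off_suppP eqxx => /negbFE/eqP.
  move=> Vz /rowP Pz; split=> //; apply/setP => i; rewrite !in_supp.
  have [x0i|x0i] := eqVneq (x0 0 i) 0; last exact: Vz.
  have ik : i \in ~: supp x0 by rewrite inE in_supp x0i eqxx.
  have := Pz (enum_rank_in ik i).
  by rewrite !mxE /off_supp enum_rankK_in// => ->; rewrite eqxx.
Qed.

Lemma manifold_same_supp : manifold_around (same_supp x0) x0.
Proof. by split=> //; exists _, V, Psi; exact: support_local_equation. Qed.

(** The coordinate directions of the support are tangent, since Psi is linear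
    and kills them. *)
Lemma normal_same_supp w : normal_subspace (same_supp x0) x0 w ->
  forall i, x0 0 i != 0 -> w 0 i = 0.
Proof.
move=> nw i x0i; rewrite -dotp_delta; apply: nw.
exists _, V, Psi; split; first exact: support_local_equation.
rewrite (diff_Psi x0); apply/rowP => k.
rewrite !mxE eqxx/= [_ == _](_ : _ = false)//.
by apply/eqP => ki; move: x0i; rewrite -ki off_suppP eqxx.
Qed.

End support_manifold.

(** * Subgradients of the 1-norm along the manifold *)
Section norm1_subgradients.
Context {R : realType} {n : nat}.
Implicit Types (x y z s v w : 'rV[R]_n).

Lemma sign_subgradient s x y :
  (forall i, `|s 0 i| <= 1 /\ s 0 i * x 0 i = `|x 0 i|) ->
  dotp s (y - x) <= norm1 y - norm1 x.
Proof.
move=> sx; rewrite dotpBr; apply: lerB.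
  apply: ler_sum => i _; apply: le_trans (ler_norm _) _.
  by rewrite normrM ler_piMl//; case: (sx i).
by apply: ler_sum => i _; case: (sx i) => _ ->.
Qed.

Definition sign_vector x := \row_(i < n) Num.sg (x 0 i).

Lemma dotp_sign x : dotp (sign_vector x) x = norm1 x.
Proof. by apply: eq_bigr => i _; rewrite mxE normrEsg. Qed.

Lemma norm1_gt0 x : x != 0 -> 0 < norm1 x.
Proof.
rewrite -normr_gt0 => /lt_le_trans; apply.
apply: norm_le_coords => [|i]; first exact: norm1_ge0.
by rewrite /norm1 (bigD1 i)//= lerDl sumr_ge0.
Qed.

(** Each coordinate of z thus lies between 0 and twice that of x, so that
    x - z / 2 and z / 2 have no coordinates of opposite sign and
    norm1 x = norm1 (x - z / 2) + norm1 (z / 2). *)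
Definition sign_close x z := forall i, `|z 0 i - x 0 i| <= `|x 0 i|.

Lemma near_sign_close x :
  \forall z \near x, same_supp x z -> sign_close x z.
Proof.
have : nbhs x [set z | forall i, x 0 i != 0 -> `|z 0 i - x 0 i| <= `|x 0 i|].
  apply: (filter_forall (F := nbhs x)
    (f := fun i (z : 'rV[R]_n) =>
      x 0 i != 0 -> `|z 0 i - x 0 i| <= `|x 0 i|)) => i.
  have [xi|xi] := boolP (x 0 i == 0); first by apply: nearW.
  have zx : (fun z : 'rV[R]_n => z 0 i) @ x --> x 0 i.
    exact: coord_continuous.
  have x0 : 0 < `|x 0 i| by rewrite normr_gt0.
  by apply: filterS (cvgr_distC_le _ _ zx _ x0) => z.
apply: filterS => z zx /setP Mz i.
have [xi|xi] := eqVneq (x 0 i) 0; last exact: zx.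
by have := Mz i; rewrite !inE xi eqxx => /negbFE/eqP ->; rewrite subrr.
Qed.

(** The triangle inequality for a - b / 2 and t / 2, where the absolute value of
    a - b / 2 is exactly that of a minus half that of b. *)
Lemma sign_close_norm (a b t : R) : `|b - a| <= `|a| ->
  `|a + 2^-1 * (t - b)| <= `|a| + 2^-1 * (`|t| - `|b|).
Proof.
rewrite !ler_norml.
case: (ger0P a); case: (ger0P b); case: (ger0P t) => ? ? ? /andP[? ?];
  by apply/andP; split; lra.
Qed.

(** Test the inequality at x at the point x + (y - z) / 2: by the previous
    estimate its 1-norm exceeds that of x by at most half of
    norm1 y - norm1 z. *)
Lemma subgradient_sign_close (X : set 'rV[R]_n) (k : R) v x z y : 0 <= k ->
  sign_close x z -> X (x + 2^-1 *: (y - z)) ->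
  (forall y, X y -> dotp v (y - x) <= k * (norm1 y - norm1 x)) ->
  dotp v (y - z) <= k * (norm1 y - norm1 z).
Proof.
move=> k0 xz Xy /(_ _ Xy); rewrite [x + _ - x]addrC addKr dotpZr => H.
have le1 : norm1 (x + 2^-1 *: (y - z)) <= norm1 x + 2^-1 * (norm1 y - norm1 z).
  rewrite /norm1 -sumrB mulr_sumr -big_split; apply: ler_sum => i _.
  by rewrite !mxE sign_close_norm.
have := ler_wpM2l k0 le1; lra.
Qed.

Lemma sign_close_sg (a b : R) : `|b - a| <= `|a| -> (a = 0 -> b = 0) ->
  Num.sg a * b = `|b|.
Proof.
move=> ba ab; case: (sgrP a) => [/ab ->|a0|a0]; first by rewrite mul0r normr0.
  rewrite mul1r ger0_norm//; move: ba; rewrite (gtr0_norm a0) ler_norml; lra.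
rewrite mulN1r ler0_norm//; move: ba; rewrite (ltr0_norm a0) ler_norml; lra.
Qed.

Lemma dotp_sign_close x z : same_supp x z -> sign_close x z ->
  dotp (sign_vector x) z = norm1 z.
Proof.
move=> /setP Mz xz; apply: eq_bigr => i _; rewrite mxE sign_close_sg// => xi.
by have := Mz i; rewrite !inE xi eqxx => /negbFE/eqP.
Qed.

End norm1_subgradients.

(** * Partial smoothness *)
Section partial_smoothness.
Context {R : realType} {n : nat}.
Variables (X : set 'rV[R]_n) (gamma : R) (Phi : 'rV[R]_n -> R).
Hypothesis closedX : closed X.
Hypothesis convexX : forall x y (t : R), X x -> X y -> 0 <= t -> t <= 1 ->
  X (x + t *: (y - x)).
(* X contains the points of the manifold near x, and the test points of
   subgradient_sign_close. *)
Hypothesis sign_closeX : forall x z y, X x -> X y -> sign_close x z ->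
  X z /\ X (x + 2^-1 *: (y - z)).
Hypothesis gamma0 : 0 < gamma.
Hypothesis smoothPhi : smooth_fun setT Phi.
Implicit Types (x y s v w : 'rV[R]_n).

Let c y := gamma / norm2 y.
Let F := Fu gamma Phi.
Let b := base_gradient gamma Phi.

Let regularE := regular_subdiff_Fu convexX gamma0 smoothPhi.

Lemma sign_regular_subdiff s x : x != 0 -> X x ->
  (forall i, `|s 0 i| <= 1 /\ s 0 i * x 0 i = `|x 0 i|) ->
  regular_subdiff (restr F X) x (b x + c x *: s).
Proof.
move=> x0 Xx sx; apply/regularE => //; split=> // y Xy.
rewrite [b x + _]addrC addrK dotpZl ler_pM2l ?sign_subgradient//.
exact: coef_gt0.
Qed.

Lemma regular_subdiff_nonempty x : x != 0 -> X x ->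
  regular_subdiff (restr F X) x !=set0.
Proof.
move=> x0 Xx; exists (b x + c x *: sign_vector x).
apply: sign_regular_subdiff => // i; rewrite mxE -normrEsg normr_sg; split=> //.
by rewrite lern1 leq_b1.
Qed.

Lemma restricted_smoothness x0 : X x0 -> x0 != 0 ->
  exists (U : set 'rV[R]_n) (g : 'rV[R]_n -> R),
    [/\ open U, U x0, smooth_fun U g
      & forall z, same_supp x0 z -> U z -> restr F X z = (g z)%:E].
Proof.
move=> Xx0 x00.
have n0 : 0 < `|x0| / 2 by rewrite divr_gt0// normr_gt0.
have [r /= r0 Hr] :=
  (nbhs_ballP _ _).1 (filterI (near_sign_close x0) (near_neq0 x00)).
exists (ball x0 (Num.min r (`|x0| / 2))).
exists (fun y => gamma / norm2 y * dotp (sign_vector x0) y + Phi y).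
have m0 : 0 < Num.min r (`|x0| / 2) by rewrite lt_min r0.
split.
- exact: ball_open.
- exact: ballxx.
- by apply: smooth_linear_over_norm2 => //; rewrite ge_min lexx orbT.
- move=> z Mz Bz.
  have [/(_ Mz) zx z0] : (same_supp x0 z -> sign_close x0 z) /\ z != 0.
    by apply: Hr; apply: le_ball Bz; rewrite ge_min lexx.
  have [Xz _] := sign_closeX Xx0 Xx0 zx.
  by rewrite restr_in// /F FuE// dotp_sign_close.
Qed.

(** The vectors sgn x0 + e sgn w, for e = 1 and e = -1, give two subgradients
    v+ and v-; the subderivative at w is at least <v+, w>, the one at -w at
    least -<v-, w>, and <v+ - v-, w> = 2 * c x0 * norm1 w > 0. *)
Lemma normal_sharpness x0 w : X x0 -> x0 != 0 ->
  normal_subspace (same_supp x0) x0 w -> w != 0 ->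
  (- subderivative (restr F X) x0 w < subderivative (restr F X) x0 (- w)%R)%E.
Proof.
move=> Xx0 x00 nw w0.
have sgw i : x0 0 i != 0 -> Num.sg (w 0 i) = 0.
  by move=> /(normal_same_supp nw) ->; rewrite sgr0.
have sub (e : R) : `|e| <= 1 -> regular_subdiff (restr F X) x0
    (b x0 + c x0 *: (sign_vector x0 + e *: sign_vector w)).
  move=> e1; apply: sign_regular_subdiff => // i; rewrite !mxE.
  have [xi|xi] := eqVneq (x0 0 i) 0; last first.
    by rewrite sgw// mulr0 addr0 -normrEsg normr_sg xi.
  rewrite xi sgr0 add0r mulr0 normr0 normrM normr_sg; split=> //.
  by rewrite mulr_ile1// lern1 leq_b1.
have d1 : `|1 : R| <= 1 by rewrite normr1.
have d2 : `|-1 : R| <= 1 by rewrite normrN1.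
have le1 := dotp_le_subderivative w (sub _ d1).
have le2 := dotp_le_subderivative (- w) (sub _ d2).
apply: lt_le_trans le2; rewrite lteNl; apply: lt_le_trans le1.
rewrite -EFinN lte_fin dotpNr opprK !dotpDl !dotpZl !dotpDl !dotpZl dotp_sign.
rewrite ltrD2l ltr_pM2l ?coef_gt0// ltrD2l ltr_pM2r ?norm1_gt0//; lra.
Qed.

(** Writing y = b x0 + c x0 *: s, the same s serves at every x^r close to x0 on
    the manifold, and b (x^r) + c (x^r) *: s tends to y. *)
Lemma subgradient_continuity x0 : X x0 -> x0 != 0 ->
  continuous_relative (limiting_subdiff (restr F X)) (same_supp x0) x0.
Proof.
move=> Xx0 x00.
have limE := limiting_subdiff_Fu closedX convexX gamma0 smoothPhi.
split=> [xr yr y _ xrx yrS yry|xr y Mxr xrx].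
  rewrite limE//.
  apply: (regular_subdiff_Fu_closed closedX convexX gamma0 smoothPhi x00
    xrx yry).
  have xr0 : \forall r \near \oo, xr r != 0 by exact: xrx (near_neq0 x00).
  by apply: filterS xr0 => r r0; rewrite -limE.
rewrite limE// => /(regularE _ x00)[_ Hy].
exists (fun r => b (xr r) + (c (xr r) / c x0) *: (y - b x0)); split.
  have xr0 : \forall r \near \oo,
      xr r != 0 /\ (same_supp x0 (xr r) -> sign_close x0 (xr r)).
    apply: filterI; first exact: xrx (near_neq0 x00).
    exact: xrx (near_sign_close x0).
  apply: filterS xr0 => r [r0 /(_ (Mxr r)) rx]; rewrite limE//.
  apply/(regularE _ r0); split; first by have [] := sign_closeX Xx0 Xx0 rx.
  move=> z Xz; have [_ Xxz] := sign_closeX Xx0 Xz rx.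
  have cr : 0 < c (xr r) by exact: coef_gt0.
  have cx : 0 < c x0 by exact: coef_gt0.
  rewrite [b (xr r) + _]addrC addrK dotpZl -/(c (xr r)) mulrAC ler_pdivrMr//.
  rewrite -[leRHS]mulrA ler_pM2l//.
  rewrite [leRHS]mulrC.
  by apply: (@subgradient_sign_close _ _ X (c x0) _ x0) => //; exact: ltW.
have brb : b (xr r) @[r --> \oo] --> b x0.
  by apply: continuous_cvg xrx; exact: base_gradient_continuous.
have crc : c (xr r) @[r --> \oo] --> c x0.
  by apply: continuous_cvg xrx; exact: continuous_coef.
have cx : c x0 != 0 by rewrite gt_eqF//; exact: coef_gt0.
have yE : y = b x0 + (c x0 / c x0) *: (y - b x0).
  by rewrite divff// scale1r addrCA subrr addr0.
rewrite [X in _ --> X]yE; apply: cvgD => //; apply: cvgZr_tmp.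
by apply: cvgM => //; exact: cvg_cst.
Qed.

Lemma partly_smooth_Fu x0 : X x0 -> x0 != 0 ->
  partly_smooth (restr F X) x0 (same_supp x0).
Proof.
move=> Xx0 x00; split.
- exact: manifold_same_supp.
- exact: restricted_smoothness.
- apply: filterS (filterI (near_sign_close x0) (near_neq0 x00)).
  move=> z [zx z0] /zx{}zx; have [Xz _] := sign_closeX Xx0 Xx0 zx.
  have rz := regular_subdiff_nonempty z0 Xz.
  by split; [exact: regular_at_Fu|rewrite limiting_subdiff_Fu].
- by move=> w; exact: normal_sharpness.
- exact: subgradient_continuity.
Qed.

End partial_smoothness.

(** * The nonnegative orthant *)
Section orthant.
Context {R : realType} {n : nat}.
Implicit Types (x y z : 'rV[R]_n).

Lemma closed_orthant : closed (@orthant R n).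
Proof.
have -> : @orthant R n = \bigcap_(i : 'I_n) [set x | - x 0 i <= 0].
  apply/seteqP; split=> x xP i; first by move=> _ /=; rewrite oppr_le0.
  by rewrite -oppr_le0; apply: xP.
apply: closed_bigI => i _; apply: closed_sublevel => x.
by apply: (cvgN (F := nbhs x)); exact: coord_continuous.
Qed.

Lemma convex_orthant x y (t : R) : orthant x -> orthant y -> 0 <= t -> t <= 1 ->
  orthant (x + t *: (y - x)).
Proof.
move=> x0 y0 t0 t1 i; rewrite !mxE.
have -> : x 0 i + t * (y 0 i - x 0 i) = (1 - t) * x 0 i + t * y 0 i by ring.
by rewrite addr_ge0// mulr_ge0// subr_ge0.
Qed.

Lemma sign_close_orthant x z y : orthant x -> orthant y -> sign_close x z ->
  orthant z /\ orthant (x + 2^-1 *: (y - z)).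
Proof.
move=> x0 y0 xz; suff H i : 0 <= z 0 i /\ 0 <= x 0 i + 2^-1 * (y 0 i - z 0 i).
  by split=> i; rewrite ?mxE; case: (H i).
have := xz i; rewrite (ger0_norm (x0 i)) ler_norml => /andP[].
have := x0 i; have := y0 i; lra.
Qed.

End orthant.

Theorem proposition1 (R : realType) (n : nat) (X : set 'rV[R]_n) (gamma : R)
    (Phi : 'rV[R]_n -> R) :
  X = setT \/ X = orthant ->
  0 < gamma ->
  smooth_fun setT Phi ->
  forall x0 : 'rV[R]_n, X x0 -> x0 != 0 ->
    partly_smooth (fun x => ((Fu gamma Phi x)%:E + ind_fun X x)%E) x0
      (same_supp x0).
Proof.
move=> [->|->] gamma0 smoothPhi x0 Xx0 x00.
  by apply: (@partly_smooth_Fu R n setT) => //; exact: closedT.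
apply: (@partly_smooth_Fu R n orthant) => //.
- exact: closed_orthant.
- exact: convex_orthant.
- exact: sign_close_orthant.
Qed.
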